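(* Let $X$ be a finite nonempty set and let $U,V\in\operatorname{Bip}(X)$. Then $V$ covers $U$ in $\operatorname{Bip}(X)$ if and only if the ordered bipartition representation of $V$ may be obtained from the ordered bipartition representation of $U$ in one of the following three ways: (i) join two adjacent underlined blocks of $U$ (into one underlined block); (ii) separate a nonunderlined block of $U$ into two adjacent (nonempty) nonunderlined blocks; or (iii) change a nonunderlined singleton block of $U$ into an underlined singleton block. Moreover, $\operatorname{Bip}(X)$ is a graded poset, with rank function $$\operatorname{rk}\bigl(U(B_1^{\varepsilon_1},B_2^{\varepsilon_2},\ldots,B_k^{\varepsilon_k})\bigr)=3\cdot\sum_{i:\varepsilon_i=1}|B_i|+\bigl|\{i:\varepsilon_i=0\}\bigr|-\bigl|\{i:\varepsilon_i=1\}\bigr|-1.$$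
   Context: A relation $U\subseteq X\times X$ on a finite set $X$ is bipartitional if both $U$ and $(X\times X)\setminus U$ are transitive. $\operatorname{Bip}(X)$ is the set of bipartitional relations on $X$, partially ordered by inclusion. An ordered partition of $X$ is an ordered list $(B_1,\ldots,B_k)$ of pairwise disjoint nonempty subsets (blocks) with union $X$. Every bipartitional relation $U$ on $X$ is represented by a unique pair consisting of an ordered partition $(B_1,\ldots,B_k)$ of $X$ and a vector $(\varepsilon_1,\ldots,\varepsilon_k)\in\{0,1\}^k$ via: $(x,y)\in U$ if and only if either $x\in B_i$, $y\in B_j$ for some $i<j$, or $x,y\in B_i$ for some $i$ with $\varepsilon_i=1$. Conversely, every such pair defines a bipartitional relation in this way. One writes $U=U(B_1^{\varepsilon_1},\ldots,B_k^{\varepsilon_k})$ and calls $(B_1^{\varepsilon_1},\ldots,B_k^{\varepsilon_k})$ the ordered bipartition representation of $U$; the block $B_i$ is underlined if $\varepsilon_i=1$ and nonunderlined if $\varepsilon_i=0$. *)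

(* Defs.v *)
From HB Require Import structures.
From mathcomp Require Import all_boot all_order all_algebra.

Set Implicit Arguments.
Unset Strict Implicit.
Unset Printing Implicit Defensive.

Import Order.TTheory GRing.Theory Num.Theory.

Section Poset.
Context {d : Order.disp_t} {T : finPOrderType d}.
Local Open Scope order_scope.

Definition covers (x y : T) : Prop := x < y /\ forall z : T, ~~ (x < z < y).

Definition chain (C : {set T}) : bool :=
  [forall x in C, forall y in C, x >=< y].

Definition minimal (x : T) : Prop := forall y : T, ~~ (y < x).

(* All maximal chains have the same length; the length of a chain is one less
   than its number of elements. *)
Definition graded : Prop :=
  exists n : nat, forall C : {set T}, maxset chain C -> #|C| = n.+1.

Definition rank_function (rk : T -> int) : Prop :=
  (forall x, minimal x -> rk x = 0%R) /\
  (forall x y, covers x y -> rk y = (rk x + 1)%R).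

End Poset.

Arguments graded {d} T.
Arguments rank_function {d T}.

Section Bipartitional.
Variable X : finType.

Definition transitive_rel (U : {set X * X}) : bool :=
  [forall x, forall y, forall z,
    ((x, y) \in U) ==> ((y, z) \in U) ==> ((x, z) \in U)].

Lemma transitive_relP (U : {set X * X}) :
  reflect (forall x y z, (x, y) \in U -> (y, z) \in U -> (x, z) \in U)
          (transitive_rel U).
Proof.
apply: (iffP forallP) => [h x y z | h x].
  by move/forallP: (h x) => /(_ y) /forallP /(_ z) /implyP h1 /h1 /implyP.
by apply/forallP => y; apply/forallP => z; apply/implyP => xy; apply/implyP; apply: h xy.
Qed.

Definition bipartitional (U : {set X * X}) : bool :=
  transitive_rel U && transitive_rel (~: U).

Record Bip := MkBip { rel_of :> {set X * X}; _ : bipartitional rel_of }.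

HB.instance Definition _ := [isSub for rel_of].
HB.instance Definition _ := [Finite of Bip by <:].

Definition Bip_le (U V : Bip) : bool := rel_of U \subset rel_of V.

Fact Bip_le_refl : reflexive Bip_le.
Proof. by move=> U; apply: subxx. Qed.

Fact Bip_le_anti : antisymmetric Bip_le.
Proof. by move=> U V UV; apply/val_inj/eqP; rewrite eqEsubset. Qed.

Fact Bip_le_trans : transitive Bip_le.
Proof. by move=> V U W; apply: subset_trans. Qed.

Fact Bip_display : Order.disp_t.
Proof. exact: Order.Disp tt tt. Qed.

HB.instance Definition _ := Order.Le_isPOrder.Build Bip_display Bip
  Bip_le_refl Bip_le_anti Bip_le_trans.

(* A pair (B, e) stands for the block B, underlined when e = true. *)
Local Notation blocks := (seq ({set X} * bool)).

Definition block (s : blocks) (i : nat) : {set X} := (nth (set0, false) s i).1.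
Definition underlined (s : blocks) (i : nat) : bool :=
  (nth (set0, false) s i).2.

Definition ordered_partition (s : seq {set X}) : bool :=
  [&& all (fun B => B != set0) s,
      pairwise (fun B C : {set X} => [disjoint B & C]) s
    & \bigcup_(B <- s) B == [set: X]].

Record obip := MkObip
  { blocks_of :> blocks; _ : ordered_partition (unzip1 blocks_of) }.

HB.instance Definition _ := [isSub for blocks_of].
HB.instance Definition _ := [Countable of obip by <:].

Definition rel_of_blocks (s : blocks) : {set X * X} :=
  [set p | [exists i : 'I_(size s), exists j : 'I_(size s),
             [&& i < j, p.1 \in block s i & p.2 \in block s j]]
        || [exists i : 'I_(size s),
             [&& underlined s i, p.1 \in block s i & p.2 \in block s i]]].

Definition in_blocks (s : blocks) (x : X) := has (fun q : {set X} * bool => x \in q.1) s.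

Lemma in_blocksP (s : blocks) x :
  reflect (exists2 i : nat, i < size s & x \in block s i) (in_blocks s x).
Proof. exact: has_nthP. Qed.

Lemma rel_of_blocks_nil : rel_of_blocks [::] = set0.
Proof.
apply/setP => p; rewrite !inE.
by apply/norP; split; apply/existsP => -[[]].
Qed.

Lemma rel_of_blocks_cons (q : {set X} * bool) (s : blocks) x y :
  (x, y) \in rel_of_blocks (q :: s) =
  [|| (x \in q.1) && in_blocks s y, [&& q.2, x \in q.1 & y \in q.1]
    | (x, y) \in rel_of_blocks s].
Proof.
rewrite !inE /=; apply/idP/idP.
  case/orP => [/existsP[[[|i] ?] /existsP[[[|j] lj] /and3P[//= ij xi yj]]]
             |/existsP[[[|i] li] /= /and3P[e xi yi]]].
  - have -> : in_blocks s y by apply/in_blocksP; exists j.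
    by rewrite [x \in _]xi.
  - apply/orP; right; apply/orP; right; apply/orP; left.
    by apply/existsP; exists (Ordinal (ltn_trans (ij : i < j) lj)); apply/existsP;
       exists (Ordinal (lj : j < size s)); apply/and3P.
  - by rewrite [q.2]e [x \in _]xi [y \in _]yi !orbT.
  - apply/orP; right; apply/orP; right; apply/orP; right.
    by apply/existsP; exists (Ordinal (li : i < size s)); apply/and3P.
case/or4P => [/andP[xq /in_blocksP[j lj yj]]|/and3P[e xq yq]
             |/existsP[i /existsP[j /and3P[ij xi yj]]]|/existsP[i /and3P[e xi yi]]].
- by apply/orP; left; apply/existsP; exists ord0; apply/existsP;
     exists (Ordinal (lj : j.+1 < (size s).+1)); apply/and3P.
- by apply/orP; right; apply/existsP; exists ord0; apply/and3P.
- by apply/orP; left; apply/existsP; exists (lift ord0 i); apply/existsP;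
     exists (lift ord0 j); apply/and3P.
- by apply/orP; right; apply/existsP; exists (lift ord0 i); apply/and3P.
Qed.

Lemma rel_of_blocks_in (s : blocks) x y :
  (x, y) \in rel_of_blocks s -> in_blocks s x && in_blocks s y.
Proof.
elim: s => [|q s IH]; first by rewrite rel_of_blocks_nil inE.
rewrite rel_of_blocks_cons /= => /or3P[/andP[-> ->]|/and3P[_ -> ->]|/IH/andP[-> ->]];
  by rewrite ?orbT.
Qed.

Definition disjoint_blocks (s : blocks) :=
  all (fun B => B != set0) (unzip1 s) &&
  pairwise (fun B C : {set X} => [disjoint B & C]) (unzip1 s).

Lemma disjoint_blocks_cons (q : {set X} * bool) (s : blocks) :
  disjoint_blocks (q :: s) ->
  [/\ q.1 != set0, forall x, x \in q.1 -> in_blocks s x = false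
    & disjoint_blocks s].
Proof.
rewrite /disjoint_blocks /= => /andP[/andP[q0 s0] /andP[qs ss]].
split=> //; last by rewrite s0.
move=> x xq; apply/negP => /hasP[r rs xr].
have /(allP qs) : r.1 \in unzip1 s by apply: map_f.
by move/disjointFr => /(_ x xq); rewrite xr.
Qed.

Lemma bigcup_in_blocks (s : blocks) :
  \bigcup_(B <- unzip1 s) B = [set x | in_blocks s x].
Proof.
elim: s => [|q s IH]; first by rewrite big_nil; apply/setP => x; rewrite !inE.
by rewrite big_cons IH; apply/setP => x; rewrite !inE.
Qed.

Lemma ordered_partitionE (s : blocks) :
  ordered_partition (unzip1 s) =
  disjoint_blocks s && [forall x, in_blocks s x].
Proof.
rewrite /ordered_partition /disjoint_blocks -andbA bigcup_in_blocks.
congr [&& _, _ & _]; apply/eqP/forallP => [/setP h x|h].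
  by have := h x; rewrite !inE.
by apply/setP => x; rewrite !inE h.
Qed.

Lemma rel_of_blocks_index (s : blocks) : disjoint_blocks s ->
  exists (f : X -> nat) (e : pred nat), forall x y, in_blocks s x -> in_blocks s y ->
    ((x, y) \in rel_of_blocks s) = (f x < f y) || (f x == f y) && e (f x).
Proof.
elim: s => [|q s IH]; first by exists (fun _ => 0), xpredT.
case/disjoint_blocks_cons => _ qs /IH[f [e fe]].
exists (fun x => if x \in q.1 then 0 else (f x).+1),
  (fun n => if n is m.+1 then e m else q.2) => x y /=.
rewrite rel_of_blocks_cons.
have nin z : z \in q.1 -> forall t, (z, t) \in rel_of_blocks s = false.
  by move=> zq t; apply/negP => /rel_of_blocks_in; rewrite qs.
have nin' z : z \in q.1 -> forall t, (t, z) \in rel_of_blocks s = false.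
  by move=> zq t; apply/negP => /rel_of_blocks_in; rewrite (qs z) ?andbF.
case xq: (x \in q.1); case yq: (y \in q.1) => //= sx sy.
- by rewrite qs // nin // andbT orbF.
- by rewrite sy.
- by rewrite nin' // andbF.
- by rewrite andbF /= fe // ltnS eqSS.
Qed.

Lemma rel_of_blocks_bipartitional (s : blocks) :
  ordered_partition (unzip1 s) -> bipartitional (rel_of_blocks s).
Proof.
rewrite ordered_partitionE => /andP[/rel_of_blocks_index[f [e fe]] /forallP cov].
apply/andP; split; apply/transitive_relP => x y z; rewrite ?in_setC !fe //.
- case: (ltngtP (f x) (f y)) => //= [xy _|->].
    by case: (ltngtP (f y) (f z)) => //= [yz _|<- _]; rewrite ?(ltn_trans xy yz) ?xy.
  by case: (ltngtP (f y) (f z)) => //=.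
- case: (ltngtP (f x) (f y)) => //= [yx _|->].
    case: (ltngtP (f y) (f z)) => //= [zy _|<- _]; last by rewrite ltnNge (ltnW yx) gtn_eqF.
    by have zx := ltn_trans zy yx; rewrite ltnNge (ltnW zx) gtn_eqF.
  by case: (ltngtP (f y) (f z)) => //=.
Qed.

(* U(B_1^e_1, ..., B_k^e_k). *)
Definition bip_of_obip (b : obip) : Bip :=
  MkBip (rel_of_blocks_bipartitional (valP b)).

Lemma mem_head_block (q : {set X} * bool) (s : blocks) x :
  disjoint_blocks (q :: s) -> in_blocks (q :: s) x ->
  (x \in q.1) = [forall y, ((y, x) \in rel_of_blocks (q :: s))
                          ==> ((x, y) \in rel_of_blocks (q :: s))].
Proof.
case/disjoint_blocks_cons => /set0Pn[z zq] qs _ sx.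
have nin t u : t \in q.1 -> (u, t) \in rel_of_blocks s = false.
  by move=> tq; apply/negP => /rel_of_blocks_in; rewrite (qs t) ?andbF.
apply/idP/forallP => [xq y|/(_ z)].
  rewrite !rel_of_blocks_cons xq (nin x) //= qs //= andbF andbT orbF /=.
  by apply/implyP => /andP[-> ->]; rewrite orbT.
rewrite !rel_of_blocks_cons zq (nin z) //= (qs z zq) andbF orbF /=.
case xq: (x \in q.1) => //=; rewrite andbF.
by move: sx => /=; rewrite xq /= => ->.
Qed.

Lemma rel_of_blocks_inj (s t : blocks) :
  disjoint_blocks s -> disjoint_blocks t -> in_blocks s =1 in_blocks t ->
  rel_of_blocks s = rel_of_blocks t -> s = t.
Proof.
elim: s t => [|[B e] s IH] [|[C c] t] //.
- move=> _ /disjoint_blocks_cons[/set0Pn[x xC] _ _] /(_ x).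
  by rewrite /= xC.
- move=> /disjoint_blocks_cons[/set0Pn[x xB] _ _] _ /(_ x).
  by rewrite /= xB.
move=> ds dt st R.
have BC : B = C.
  apply/setP => x; have sx := st x; case inx: (in_blocks ((B, e) :: s) x).
    by rewrite (mem_head_block ds) // (mem_head_block dt) -?sx // R.
  move: (inx); rewrite sx => /=; move: inx => /= /norP[/negPf-> _].
  by case/norP => /negPf->.
subst C.
have [/= /set0Pn[x xB] Bs ds'] := disjoint_blocks_cons ds.
have [/= _ Bt dt'] := disjoint_blocks_cons dt.
have nin r z u (h : forall x, x \in B -> in_blocks r x = false) :
    (z, u) \in rel_of_blocks r = [&& z \notin B, u \notin B & (z, u) \in rel_of_blocks r].
  case zu: ((z, u) \in _); last by rewrite !andbF.
  have /andP[rz ru] := rel_of_blocks_in zu.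
  by rewrite !(contraL (fun k => negbT (h _ k))).
have ec : e = c.
  move/setP/(_ (x, x)): R; rewrite !rel_of_blocks_cons /= xB Bs // Bt // /= !andbT.
  by rewrite (nin s) // (nin t) // xB /= !orbF.
subst c; congr (_ :: _); apply: IH => // [y|].
  have := st y => /=; case yB: (y \in B) => //= _.
  by rewrite Bs // Bt.
apply/setP => -[y z]; rewrite (nin s) // (nin t) //.
have /setP/(_ (y, z)) := R; rewrite !rel_of_blocks_cons /=.
by case: (y \in B); case: (z \in B); rewrite //= !andbF.
Qed.

Lemma bip_of_obip_inj : injective bip_of_obip.
Proof.
move=> b c /(congr1 rel_of) /= R; apply/val_inj.
have := valP b; have := valP c; rewrite !ordered_partitionE.
move=> /andP[dc /forallP cc] /andP[db /forallP cb].
by apply: rel_of_blocks_inj => // x; rewrite cb cc.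
Qed.

Lemma rel_of_blocks_levels (f : X -> nat) (e : pred nat) (l : seq nat) x y :
  sorted ltn l ->
  ((x, y) \in rel_of_blocks [seq ([set z | f z == n], e n) | n <- l]) =
  [&& f x \in l, f y \in l & (f x < f y) || (f x == f y) && e (f x)].
Proof.
have inl k z : in_blocks [seq ([set z | f z == n], e n) | n <- k] z = (f z \in k).
  by elim: k => //= n k ->; rewrite !inE.
elim: l => [|n l IH] /=; first by rewrite rel_of_blocks_nil inE.
rewrite (path_sortedE ltn_trans) => /andP[/allP nl sl].
rewrite rel_of_blocks_cons /= IH // inl !inE.
case: (eqVneq (f x) n) => [->|_] /=; last first.
  rewrite andbF /=; case: (eqVneq (f y) n) => [->|_] //=.
  case fl: (f x \in l); last by [].
  have nx := nl _ fl.
  by rewrite ltnNge (ltnW nx) gtn_eqF //= andbF.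
have nnl : n \in l = false by apply/negP => /nl; rewrite ltnn.
case: (eqVneq (f y) n) => [->|yn] /=; first by rewrite nnl ltnn andbT orbF.
rewrite nnl andbF orbF; case fl: (f y \in l) => //=.
by rewrite (nl _ fl).
Qed.

Lemma bip_of_obip_surj (U : Bip) : exists b : obip, bip_of_obip b == U.
Proof.
case: U => U bU; have /andP[/transitive_relP tU /transitive_relP] := bU.
move=> tC'.
have tC x y z : (x, y) \notin U -> (y, z) \notin U -> (x, z) \notin U.
  by rewrite -!in_setC; apply: tC'.
pose lt x y := ((x, y) \in U) && ((y, x) \notin U).
pose f x := #|[set z | lt z x]|.
have ltT x y z : lt x y -> lt y z -> lt x z.
  case/andP => xy nyx /andP[yz nzy]; rewrite /lt (tU _ _ _ xy yz) /=.
  by apply/negP => zx; move/negP: nzy; apply; apply: tU zx xy.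
have ltf x y : lt x y -> f x < f y.
  move=> xy; apply: proper_card; apply/properP; split.
    by apply/subsetP => z; rewrite !inE => zx; apply: ltT xy.
  by exists x; rewrite !inE // /lt andbN.
have eqf1 x y : ((x, y) \in U) = ((y, x) \in U) -> forall z, lt z x -> lt z y.
  move=> xy z /andP[zx nxz]; rewrite /lt.
  case Exy: ((x, y) \in U) xy => /esym yx.
    rewrite (tU _ _ _ zx Exy) /=; apply/negP => yz.
    by move/negP: nxz; apply; apply: tU Exy yz.
  have nyz : (y, z) \notin U by apply: tC nxz; rewrite yx.
  rewrite nyz andbT; apply/negPn/negP => nzy.
  by have := tC _ _ _ nzy (negbT yx); rewrite zx.
have eqf x y : ((x, y) \in U) = ((y, x) \in U) -> f x = f y.
  move=> xy; apply: eq_card => z; rewrite !inE.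
  by apply/idP/idP; apply: eqf1.
pose e n := [exists x, (f x == n) && ((x, x) \in U)].
have Ue x y : ((x, y) \in U) = ((y, x) \in U) -> ((x, y) \in U) = ((x, x) \in U).
  case xy: ((x, y) \in U) => /esym yx; first by rewrite (tU _ _ _ xy yx).
  by apply/esym/negbTE; apply: tC (negbT xy) (negbT yx).
have feq x y : f x = f y -> ((x, y) \in U) = ((y, x) \in U).
  move=> fxy; case xy: ((x, y) \in U); case yx: ((y, x) \in U) => //.
    by have := ltf x y; rewrite /lt xy yx fxy ltnn => /(_ isT).
  by have := ltf y x; rewrite /lt xy yx fxy ltnn => /(_ isT).
have UE x y : ((x, y) \in U) = (f x < f y) || (f x == f y) && e (f x).
  case: (ltngtP (f x) (f y)) => /= fxy.
  - apply/negPn/negP => nxy; case yx: ((y, x) \in U).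
      have := ltf y x; rewrite /lt yx nxy => /(_ isT).
      by rewrite ltnNge ltnW.
    by move: fxy; rewrite (eqf x y) ?ltnn // yx; apply/negbTE.
  - apply/negP => xy; case yx: ((y, x) \in U).
      by move: fxy; rewrite (eqf x y) ?ltnn // xy yx.
    have := ltf x y; rewrite /lt yx xy => /(_ isT).
    by rewrite ltnNge ltnW.
  - rewrite (Ue _ _ (feq _ _ fxy)); apply/idP/existsP => [xx|[z /andP[/eqP fz zz]]].
      by exists x; rewrite eqxx.
    have zx := feq _ _ fz; move: (zx) => /esym /Ue <-.
    by rewrite -zx (Ue _ _ zx).
pose l := [seq n <- iota 0 #|X|.+1 | [set z | f z == n] != set0].
have fl x : f x \in l.
  rewrite mem_filter mem_iota /= add0n ltnS max_card andbT.
  by apply/set0Pn; exists x; rewrite inE.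
have sl : sorted ltn l by apply: (sorted_filter ltn_trans); apply: iota_ltn_sorted.
pose s := [seq ([set z | f z == n], e n) | n <- l].
have ps : ordered_partition (unzip1 s).
  rewrite ordered_partitionE -andbA /unzip1 -map_comp; apply/and3P; split.
  - by rewrite all_map; apply/allP => n /=; rewrite mem_filter => /andP[].
  - have ul : uniq l by rewrite filter_uniq ?iota_uniq.
    rewrite pairwise_map; move: ul; rewrite uniq_pairwise.
    apply: sub_pairwise => m n /= mn; rewrite -setI_eq0; apply/eqP/setP => z.
    rewrite in_setI !in_set; apply/negP => /andP[/eqP fm /eqP fn].
    by rewrite -fm -fn eqxx in mn.
  - apply/forallP => x; rewrite /in_blocks has_map; apply/hasP.
    by exists (f x); rewrite //= inE.
exists (MkObip ps); apply/eqP/val_inj/setP => -[x y] /=.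
by rewrite rel_of_blocks_levels // !fl UE.
Qed.

Definition obip_repr (U : Bip) : obip := xchoose (bip_of_obip_surj U).

Lemma obip_reprK : cancel obip_repr bip_of_obip.
Proof. by move=> U; apply/eqP/(xchooseP (bip_of_obip_surj U)). Qed.

Lemma bip_of_obipK : cancel bip_of_obip obip_repr.
Proof. by move=> b; apply: bip_of_obip_inj; rewrite obip_reprK. Qed.

Definition join_underlined (b c : blocks) : Prop :=
  exists (s t : blocks) (B C : {set X}),
    b = s ++ [:: (B, true), (C, true) & t] /\
    c = s ++ (B :|: C, true) :: t.

Definition separate_nonunderlined (b c : blocks) : Prop :=
  exists (s t : blocks) (B C : {set X}),
    [/\ B != set0, C != set0, [disjoint B & C],
        b = s ++ (B :|: C, false) :: t &
        c = s ++ [:: (B, false), (C, false) & t]].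

Definition underline_singleton (b c : blocks) : Prop :=
  exists (s t : blocks) (x : X),
    b = s ++ ([set x], false) :: t /\ c = s ++ ([set x], true) :: t.

Definition bip_rank (U : Bip) : int :=
  (3 * (\sum_(p <- obip_repr U | p.2) #|p.1|)%N%:Z
   + (count (fun p => ~~ p.2) (obip_repr U))%:Z
   - (count (fun p => p.2) (obip_repr U))%:Z - 1)%R.

End Bipartitional.

(* Main.v *)
(** If [U < V], some move (i)-(iii) leads from [U] to a [W <= V]: if [V] meets
    [B * B] for a nonunderlined block [B] of [U], then [B] can be underlined or
    cut; otherwise [V] contains a pair [(x, y)] with the block of [y] before
    that of [x], and transitivity forces the block of [y] and its successor to
    be underlined and merged in [V].  Every move enlarges the relation and
    raises the rank by one, so the rank is strictly increasing, the moves are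
    exactly the covers, and a maximal chain takes every rank between those of
    the empty and of the full relation exactly once. *)
Require Import Defs.
From mathcomp Require Import all_boot all_order all_algebra.
From mathcomp Require Import zify.

Set Implicit Arguments.
Unset Strict Implicit.
Unset Printing Implicit Defensive.

Import Order.TTheory GRing.Theory Num.Theory.

(** * Finite posets with a rank that can be raised one step at a time *)

Section StepwiseRank.
Context {d : Order.disp_t} {T : finPOrderType d}.
Local Open Scope order_scope.

Variable rk : T -> int.
Hypothesis rk_step :
  forall x y : T, x < y -> exists2 z, x < z <= y & rk z = (rk x + 1)%R.

(** Induction on the size of the interval []x, y]], which loses [z] when [x] moves up to the
    intermediate element [z]. *)
Lemma stepwise_rank_lt (x y : T) : x < y -> (rk x < rk y)%R.
Proof.
have [n le_n] := ubnP #|[set z | x < z <= y]|.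
elim: n x le_n => // n IH x le_n xy.
have [z /andP[xz zy] rkz] := rk_step xy.
have : (rk x < rk z)%R by rewrite rkz ltrDl.
have [-> //|z'y] := eqVneq z y; move/lt_trans; apply.
apply: IH; last by rewrite lt_neqAle z'y.
rewrite -ltnS; apply: leq_trans le_n; rewrite ltnS; apply: proper_card.
apply/properP; split.
  by apply/subsetP => w; rewrite !inE => /andP[/(lt_trans xz)-> ->].
by exists z; rewrite !inE ?xz ?zy // ltxx.
Qed.

Lemma stepwise_rank_covers (x y : T) : covers x y -> rk y = (rk x + 1)%R.
Proof.
case=> /rk_step[z /andP[xz zy] <-] /(_ z); rewrite xz /= => nzy.
by congr rk; apply/eqP; move: nzy; rewrite lt_neqAle zy andbT negbK eq_sym.
Qed.

(** Strictly increasing integer ranks leave no room between n and n + 1. *)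
Lemma covers_of_rank (x y : T) : x < y -> rk y = (rk x + 1)%R -> covers x y.
Proof.
move=> xy rky; split=> // z; apply/negP => /andP[xz zy].
by have := stepwise_rank_lt zy; rewrite rky ltzD1 leNgt (stepwise_rank_lt xz).
Qed.

Lemma maxset_chain_mem (C : {set T}) (x : T) :
  maxset chain C -> (forall y, y \in C -> x >=< y) -> x \in C.
Proof.
move=> /maxsetP[/forall_inP chC maxC] xC.
suff <- : x |: C = C by rewrite setU11.
apply: maxC; last exact: subsetUr.
apply/forall_inP => y /setU1P[->|yC]; apply/forall_inP => z /setU1P[->|zC].
- exact: comparablexx.
- exact: xC.
- by rewrite comparable_sym; apply: xC.
- exact: (forall_inP (chC y yC)).
Qed.

(** The successor of [x] in [C] is the element [z] of least rank above [x]. The step [w] from [x]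
    towards [z] is comparable to all of [C], so it lies in [C] and must be [z]. *)
Lemma maxset_chain_next (C : {set T}) (x y : T) :
  maxset chain C -> x \in C -> y \in C -> x < y ->
  exists2 z, z \in C & rk z = (rk x + 1)%R.
Proof.
move=> mC xC yC xy.
have chC u v : u \in C -> v \in C -> u >=< v.
  by case/maxsetP: mC => /forall_inP chC _ uC; move: v; apply/forall_inP/chC.
have P0 : [pred z | (z \in C) && (x < z)] y by rewrite /= yC.
case: (Order.TotalTheory.arg_minP rk P0) => z /andP[zC xz] zmin.
exists z => //; have [w /andP[xw wz] rkw] := rk_step xz.
have [<- //|w'z] := eqVneq w z.
have {w'z} wz' : w < z by rewrite lt_neqAle w'z.
have rkwz := stepwise_rank_lt wz'.
have wC : w \in C.
  apply: (maxset_chain_mem mC) => u uC.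
  case: (comparable_leP (chC _ _ uC xC)) => [ux|xu].
    by rewrite /Order.comparable (le_trans ux (ltW xw)) orbT.
  (* Any element of [C] above [x] has at least the rank of [z], so it cannot lie strictly below
     [z]. *)
  have := zmin u; rewrite /= uC xu => /(_ isT) zu.
  case: (comparable_leP (chC _ _ zC uC)) => [le_zu|/stepwise_rank_lt]; last by rewrite ltNge zu.
  by rewrite /Order.comparable (le_trans wz le_zu).
by have := zmin w; rewrite /= wC xw => /(_ isT); rewrite leNgt rkwz.
Qed.

(** The height [g] over [bot] maps a maximal chain bijectively onto 0, ..., [g top]: it is injective
    by strict monotonicity, and every height is reached by climbing from [bot]. *)
Lemma stepwise_rank_graded (bot top : T) :
  (forall x, bot <= x) -> (forall x, x <= top) -> graded T.
Proof.
move=> bot_le le_top.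
have rk_le x y : x <= y -> (rk x <= rk y)%R.
  by rewrite le_eqVlt => /predU1P[->//|/stepwise_rank_lt/ltW].
pose g x := `|rk x - rk bot|%N.
have gE x : (rk x = rk bot + g x)%R.
  by rewrite /g gez0_abs ?subr_ge0 ?rk_le // addrCA subrr addr0.
exists (g top) => C mC.
have chC u v : u \in C -> v \in C -> u >=< v.
  by case/maxsetP: mC => /forall_inP chC _ uC; move: v; apply/forall_inP/chC.
have g_lt x : (g x < (g top).+1)%N.
  by rewrite ltnS -lez_nat -(lerD2l (rk bot)) -!gE rk_le.
pose h x := Ordinal (g_lt x).
have h_inj : {in C &, injective h}.
  move=> x y xC yC [/= gxy].
  have rkxy : rk x = rk y by rewrite (gE x) gxy -gE.
  case: (comparable_ltgtP (chC _ _ xC yC)) => // /stepwise_rank_lt;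
  by rewrite rkxy ltxx.
rewrite -(card_in_imset h_inj) -[RHS]card_ord -cardsT.
congr #|pred_of_set _|; apply/setP => -[k lt_k]; rewrite inE.
suff [x xC gx] : exists2 x, x \in C & g x = k.
  by apply/imsetP; exists x => //; apply: val_inj; rewrite /= gx.
have topC : top \in C.
  by apply: (maxset_chain_mem mC) => x _; rewrite /Order.comparable le_top orbT.
elim: k lt_k => [_|k IH lt_k].
  exists bot; last by rewrite /g subrr.
  by apply: (maxset_chain_mem mC) => x _; rewrite /Order.comparable bot_le.
have [x xC gx] := IH (ltnW lt_k).
have x_top : x < top.
  by rewrite lt_neqAle le_top andbT; apply/eqP => xtop; move: lt_k; rewrite -gx xtop ltnn.
have [z zC rkz] := maxset_chain_next mC xC topC x_top.
by exists z => //; move: rkz; rewrite (gE z) (gE x) gx -addrA => /addrI; rewrite -PoszD addn1 => -[].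
Qed.

End StepwiseRank.

Section Moves.
Variable X : finType.
Local Notation blocks := (seq ({set X} * bool)).
Implicit Types (s t m b c : blocks) (V : {set X * X}) (B C : {set X}).

(** * Replacing a segment of a block list *)

Lemma in_blocks_cat s t x : in_blocks (s ++ t) x = in_blocks s x || in_blocks t x.
Proof. exact: has_cat. Qed.

Lemma rel_of_blocks_cat s t x y :
  (x, y) \in rel_of_blocks (s ++ t) =
  [|| in_blocks s x && in_blocks t y, (x, y) \in rel_of_blocks s
    | (x, y) \in rel_of_blocks t].
Proof.
elim: s => [|q s IH] /=; first by rewrite rel_of_blocks_nil in_set0.
rewrite !rel_of_blocks_cons IH in_blocks_cat andb_orr /=.
by rewrite andb_orl -!orbA; case: (x \in q.1) => //=; case: (in_blocks s y) => //=;
   case: (in_blocks t y) => //=; case: (in_blocks s x); rewrite ?orbT.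
Qed.

Lemma disjoint_blocks_cat s t :
  disjoint_blocks (s ++ t) =
  [&& disjoint_blocks s, disjoint_blocks t
    & [forall x, ~~ (in_blocks s x && in_blocks t x)]].
Proof.
rewrite /disjoint_blocks /unzip1 map_cat all_cat pairwise_cat.
suff -> : allrel (fun B C => [disjoint B & C]) (map fst s) (map fst t) =
          [forall x, ~~ (in_blocks s x && in_blocks t x)].
  by do !case: (all _ _) => //=; do !case: (pairwise _ _) => //=; rewrite ?andbF ?andbT.
apply/allrelP/forallP => [dst x|dst B C].
  apply/negP => /andP[/hasP[q qs xq] /hasP[r rt xr]].
  by have := disjointFr (dst _ _ (map_f fst qs) (map_f fst rt)) xq; rewrite xr.
case/mapP => q qs ->; case/mapP => r rt ->; rewrite disjoint_subset.
apply/subsetP => x xq; apply/negP => xr.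
by move/negP: (dst x); apply; apply/andP; split; apply/hasP; [exists q|exists r].
Qed.

(** The rest of the list sees a segment only through the set of points it covers. *)
Lemma ordered_partition_subst s m m' t :
  in_blocks m =1 in_blocks m' -> disjoint_blocks m' ->
  ordered_partition (unzip1 (s ++ m ++ t)) ->
  ordered_partition (unzip1 (s ++ m' ++ t)).
Proof.
move=> mm' dm'; rewrite !ordered_partitionE !disjoint_blocks_cat dm'.
move=> /andP[/and3P[-> /and3P[_ -> /forallP dmt] /forallP dsm] /forallP cov] /=.
rewrite -andbA; apply/and3P; split; apply/forallP => x.
- by rewrite -mm'.
- by have := dsm x; rewrite !in_blocks_cat mm'.
- by have := cov x; rewrite !in_blocks_cat mm'.
Qed.

(** Only the pairs of [rel_of_blocks m'] need checking: all others depend on the segment just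
    through its set of points, which does not change. *)
Lemma rel_of_blocks_subst V s m m' t :
  in_blocks m =1 in_blocks m' -> rel_of_blocks m' \subset V ->
  rel_of_blocks (s ++ m ++ t) \subset V -> rel_of_blocks (s ++ m' ++ t) \subset V.
Proof.
move=> mm' m'V /subsetP smtV; apply/subsetP => -[x y].
have := smtV (x, y); rewrite !rel_of_blocks_cat !in_blocks_cat !mm'.
move=> h; case m'xy: ((x, y) \in rel_of_blocks m').
  by rewrite (subsetP m'V _ m'xy).
move=> xy; apply: h; move: xy; case: ((x, y) \in rel_of_blocks m) => //.
by rewrite ?orbT.
Qed.

Lemma rel_of_blocks_context s m m' t :
  in_blocks m =1 in_blocks m' -> rel_of_blocks m \subset rel_of_blocks m' ->
  rel_of_blocks (s ++ m ++ t) \subset rel_of_blocks (s ++ m' ++ t).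
Proof.
move=> mm' /subset_trans mm'S.
apply: (@rel_of_blocks_subst _ s m' m t) => [x|//|//]; first by rewrite mm'.
apply: mm'S; apply/subsetP => -[x y] xy.
by rewrite !rel_of_blocks_cat xy !orbT.
Qed.

(** * Effect of the moves on rank and relation *)

Definition block_weight (p : {set X} * bool) : int :=
  if p.2 then (3 * #|p.1|%:Z - 1)%R else 1%R.

(** As a sum over blocks, the rank changes under a move only through the blocks that the move
    touches. *)
Lemma bip_rankE (U : Bip X) :
  bip_rank U = (\sum_(p <- obip_repr U) block_weight p - 1)%R.
Proof.
rewrite /bip_rank; congr (_ - 1)%R; elim: (blocks_of _) => [|p s IH].
  by rewrite !big_nil.
by rewrite !big_cons /= -IH /block_weight; case: p.2 => /=; lia.
Qed.

Definition move b c : Prop :=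
  [\/ join_underlined b c, separate_nonunderlined b c | underline_singleton b c].

(** A join turns (3|B| - 1) + (3|C| - 1) into 3(|B| + |C|) - 1, by disjointness; a separation turns
    1 into 1 + 1; underlining a singleton turns 1 into 3 - 1. *)
Lemma move_weight b c : disjoint_blocks b -> move b c ->
  (\sum_(p <- c) block_weight p = \sum_(p <- b) block_weight p + 1)%R.
Proof.
move=> db [] [s [t [B]]].
- case=> C [bE ->]; move: db; rewrite bE disjoint_blocks_cat.
  case/and3P => _ /disjoint_blocks_cons[_ dBC _] _.
  rewrite !big_cat !big_cons /block_weight /= cardsU.
  suff -> : B :&: C = set0 by rewrite cards0; lia.
  apply/setP => x; rewrite !inE; apply/negP => /andP[/dBC/=].
  by case: (x \in C).
- by case=> C [_ _ _ -> ->]; rewrite !big_cat !big_cons /block_weight /=; lia.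
- by case=> -> ->; rewrite !big_cat !big_cons /block_weight /= cards1; lia.
Qed.

Lemma in_blocks_join B C e e' e'' :
  in_blocks [:: (B, e); (C, e')] =1 in_blocks [:: (B :|: C, e'')].
Proof. by move=> x; rewrite /= !orbF inE. Qed.

Lemma rel_of_blocks1 B e :
  rel_of_blocks [:: (B, e)] = if e then setX B B else set0.
Proof.
apply/setP => -[x y]; rewrite rel_of_blocks_cons rel_of_blocks_nil !inE /= andbF orbF /=.
by case: e; rewrite !inE.
Qed.

Lemma rel_of_blocks2 B C e :
  rel_of_blocks [:: (B, e); (C, e)] =
  setX B C :|: (if e then setX B B :|: setX C C else set0).
Proof.
apply/setP => -[x y]; rewrite rel_of_blocks_cons rel_of_blocks1 /= orbF.
by case: e; rewrite !inE.
Qed.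

(** The three moves add [setX C B], [setX B C] and the pair [(x, x)], respectively. *)
Lemma move_sub b c : move b c -> rel_of_blocks b \subset rel_of_blocks c.
Proof.
case=> [[s [t [B [C [-> ->]]]]]|[s [t [B [C [_ _ _ -> ->]]]]]|[s [t [x [-> ->]]]]].
- apply: (@rel_of_blocks_context s [:: (B, true); (C, true)] [:: (B :|: C, true)]).
    exact: in_blocks_join.
  by rewrite rel_of_blocks1 rel_of_blocks2 !subUset !setXS ?subsetUl ?subsetUr.
- apply: (@rel_of_blocks_context s [:: (B :|: C, false)] [:: (B, false); (C, false)]).
    by move=> x; rewrite -(in_blocks_join _ _ false false).
  by rewrite rel_of_blocks1 sub0set.
- apply: (@rel_of_blocks_context s [:: ([set x], false)] [:: ([set x], true)]) => //.
  by rewrite (rel_of_blocks1 _ false) sub0set.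
Qed.

(** * Finding a move towards a larger bipartitional relation *)

(** As the complement of [V] is transitive, [V] relates each point before a given point to each
    point not before it, and each point not after it to each point after it. Such a split is a cut
    once both sides are nonempty. *)
Lemma exists_cut V B x y : bipartitional V -> x \in B -> y \in B ->
  (x, y) \in V -> 1 < #|B| ->
  exists C D, [/\ C != set0, D != set0, [disjoint C & D], B = C :|: D
                & setX C D \subset V].
Proof.
case/andP => _ /transitive_relP tC' xB yB xyV B1.
have tC u v w : (u, w) \in V -> (u, v) \in V \/ (v, w) \in V.
  case uv: ((u, v) \in V); first by left.
  case vw: ((v, w) \in V); first by right.
  by have := tC' u v w; rewrite !inE uv vw => /(_ isT isT) /negPf->.
(* [P] selects the front block [C]. *)
suff [P [[u uB Pu] [v vB Pv] PV]] : exists P : pred X,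
    [/\ exists2 u, u \in B & P u, exists2 v, v \in B & ~~ P v
      & forall u v, u \in B -> v \in B -> P u -> ~~ P v -> (u, v) \in V].
  exists [set z in B | P z], [set z in B | ~~ P z]; split.
  - by apply/set0Pn; exists u; rewrite inE uB.
  - by apply/set0Pn; exists v; rewrite inE vB.
  - rewrite -setI_eq0; apply/eqP/setP => z; rewrite !inE.
    by case: (P z); rewrite ?andbF.
  - by apply/setP => z; rewrite !inE -andb_orr orbN andbT.
  - apply/subsetP => -[z w]; rewrite !inE => /andP[/andP[zB Pz] /andP[wB Pw]].
    exact: PV.
(* If [V] contains the whole square of [B], any cut will do: split off [x]. *)
have [/subsetP BV|/subsetPn[[u v]]] := boolP (setX B B \subset V).
  have [z zB zx] : exists2 z, z \in B & z != x.
    have /card_gt1P[z [w [zB wB zw]]] := B1.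
    by have [zx|] := eqVneq z x; [exists w; rewrite // -zx eq_sym|exists z].
  exists (pred1 x); split=> [||? w]; [by exists x => /=|by exists z|].
  by move=> uB wB _ _; apply: BV; rewrite inE uB.
rewrite inE /= => /andP[uB vB] uvV.
case uyV: ((u, y) \in V).
  (* The front is the set of points not after [u]; it has [v] but not [y]. *)
  exists (fun z => (u, z) \notin V); split; first by exists v.
    by exists y; rewrite ?uyV.
  by move=> z w _ _ uz; rewrite negbK => /(tC _ z)[/(negP uz)|].
(* The front is the set of points before [y]; it has [x] but not [u]. *)
exists (fun z => (z, y) \in V); split; first by exists x.
  by exists u; rewrite ?uyV.
by move=> z w _ _ /(tC _ w)[//|wy]; rewrite wy.
Qed.

(** Induction on the list reduces to [y] lying in the first block. Then [x] lies further on, and the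
    first two blocks can be joined: each point of the second reaches [y] through [x]. *)
Lemma exists_merge V b x y : transitive_rel V -> disjoint_blocks b ->
  rel_of_blocks b \subset V ->
  (forall q, q \in b -> ~~ q.2 -> [disjoint setX q.1 q.1 & V]) ->
  in_blocks b x -> in_blocks b y -> (x, y) \in V -> (x, y) \notin rel_of_blocks b ->
  exists s t B C, b = s ++ [:: (B, true), (C, true) & t] /\ setX C B \subset V.
Proof.
move/transitive_relP => tV; elim: b => // q b IH db bV nonV xb yb xyV.
(* A block with a loop of [V] is underlined, since [V] avoids the squares of the others. *)
have underlinedP p z : p \in q :: b -> z \in p.1 -> (z, z) \in V -> p.2.
  move=> pb zp zzV; apply/negPn/negP => /(nonV _ pb)/pred0P/(_ (z, z)) /=.
  by rewrite inE zp zzV.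
have [_ qb db'] := disjoint_blocks_cons db.
rewrite rel_of_blocks_cons !negb_or => /and3P[xyq xyqq xyb].
have bV' : rel_of_blocks b \subset V.
  apply: subset_trans bV; apply/subsetP => -[u v] uv.
  by rewrite rel_of_blocks_cons uv !orbT.
(* If [y] is not in the head, neither is [x], or [(x, y)] would already be in the relation; go on
   with the tail. *)
case yq: (y \in q.1); last first.
  move: yb; rewrite /= yq /= => yb; move: xyq; rewrite yb andbT => xq.
  move: xb; rewrite /= (negPf xq) /= => xb.
  have [|s [t [B [C [-> CB]]]]] := IH db' bV' _ xb yb xyV xyb.
    by move=> p pb; apply: nonV; rewrite inE pb orbT.
  by exists (q :: s), t, B, C.
case xq: (x \in q.1).
  have q2 : ~~ q.2 by move: xyqq; rewrite xq yq !andbT.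
  have /pred0P/(_ (x, y)) := nonV q (mem_head _ _) q2.
  by rewrite /= inE xq yq xyV.
move: xb; rewrite /= xq /= => {IH nonV bV'} xb.
have yxV : (y, x) \in V.
  by apply: (subsetP bV); rewrite rel_of_blocks_cons yq xb.
have q2 : q.2 by apply: (underlinedP _ y) => //; [exact: mem_head|exact: tV xyV].
case: b xb db db' bV underlinedP {qb yb xyb xyq xyqq} => // r b xb db db' bV underlinedP.
have [/set0Pn[r0 r0r] rb _] := disjoint_blocks_cons db'.
(* [V] relates [z] to [x]: either both lie in [r], underlined by the loop at [x], or [x] lies in a
   later block. *)
have {r0 r0r} zyV z : z \in r.1 -> (z, y) \in V.
  move=> zr; apply: (tV _ _ _ _ xyV); move: xb => /=; case xr: (x \in r.1) => /= xb.
    have r2 : r.2 by apply: (underlinedP _ x) => //; [rewrite !inE eqxx orbT|exact: tV yxV].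
    by apply: (subsetP bV); rewrite !rel_of_blocks_cons r2 xr zr /= !orbT.
  by apply: (subsetP bV); rewrite !rel_of_blocks_cons zr xb /= !orbT.
have r2 : r.2.
  have [/set0Pn[z zr] _ _] := disjoint_blocks_cons db'.
  apply: (underlinedP _ z) => //; first by rewrite !inE eqxx orbT.
  apply: tV (zyV z zr) _; apply: (subsetP bV).
  by rewrite rel_of_blocks_cons yq /= zr.
exists [::], b, q.1, r.1; split.
  by case: q r q2 r2 {db db' rb zyV underlinedP bV xb yq xq} => [B []] [C []].
apply/subsetP => -[z w]; rewrite inE /= => /andP[zr wq].
apply: tV (zyV z zr) _; apply: (subsetP bV).
by rewrite rel_of_blocks_cons q2 yq wq !orbT.
Qed.

Lemma exists_move V b : bipartitional V -> ordered_partition (unzip1 b) ->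
  rel_of_blocks b \proper V ->
  exists c, [/\ ordered_partition (unzip1 c), move b c & rel_of_blocks c \subset V].
Proof.
move=> bV pb /properP[rbV [[x y] xyV xynb]].
have := pb; rewrite ordered_partitionE => /andP[db /forallP cov].
have [/hasP[[B e] Bb /andP[/= e0 /pred0Pn[[u v] /= /andP[]]]]|/hasPn nonV] :=
  boolP (has (fun q : {set X} * bool => ~~ q.2 && ~~ [disjoint setX q.1 q.1 & V]) b).
  rewrite inE /= => /andP[uB vB] uvV; move: pb rbV {xynb db cov}.
  case/splitPr: {b} Bb e0 => s t; case: e => // _ pb rbV.
  (* A block of at least two points is cut; a singleton is underlined. *)
  have [B1|B1] := ltnP 1 #|B|.
    have [C [D [C0 D0 dCD BE CDV]]] := exists_cut bV uB vB uvV B1.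
    have sub : in_blocks [:: (B, false)] =1 in_blocks [:: (C, false); (D, false)].
      by move=> z; rewrite BE -(in_blocks_join _ _ false false).
    exists (s ++ [:: (C, false), (D, false) & t]); split.
    - apply: (@ordered_partition_subst s _ [:: (C, false); (D, false)] t sub) => //.
      by rewrite /disjoint_blocks /= C0 D0 dCD.
    - by apply: Or32; exists s, t, C, D; rewrite -BE.
    - apply: (@rel_of_blocks_subst _ s _ [:: (C, false); (D, false)] t sub) => //.
      by rewrite rel_of_blocks2 setU0.
  have {B1} BE : B = [set u].
    by apply/esym/eqP; rewrite eqEcard sub1set uB cards1.
  move: vB uvV pb rbV; rewrite {}BE inE => /eqP-> uuV pb rbV.
  exists (s ++ ([set u], true) :: t); split.
  - apply: (@ordered_partition_subst s [:: ([set u], false)] [:: ([set u], true)] t) => //.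
    by rewrite /disjoint_blocks /= !andbT; apply/set0Pn; exists u; rewrite inE.
  - by apply: Or33; exists s, t, u.
  - apply: (@rel_of_blocks_subst _ s [:: ([set u], false)] [:: ([set u], true)] t) => //.
    rewrite rel_of_blocks1; apply/subsetP => -[w z]; rewrite !inE /=.
    by case/andP => /eqP-> /eqP->.
have [q qb q2|s [t [B [C [bE CBV]]]]] :=
  exists_merge (andP bV).1 db rbV _ (cov x) (cov y) xyV xynb.
  by have := nonV q qb; rewrite q2 negbK.
subst b.
have sub : in_blocks [:: (B, true); (C, true)] =1 in_blocks [:: (B :|: C, true)].
  exact: in_blocks_join.
exists (s ++ (B :|: C, true) :: t); split.
- apply: (@ordered_partition_subst s [:: (B, true); (C, true)] [:: (_, _)] t) => //.
  rewrite /disjoint_blocks /= !andbT; move: db; rewrite disjoint_blocks_cat.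
  case/and3P => _ /disjoint_blocks_cons[/set0Pn[z zB] _ _] _.
  by apply/set0Pn; exists z; rewrite inE zB.
- by apply: Or31; exists s, t, B, C.
- apply: (@rel_of_blocks_subst _ s [:: (B, true); (C, true)] [:: (_, _)] t) => //.
  have : rel_of_blocks [:: (B, true); (C, true)] \subset V.
    apply: subset_trans rbV; apply/subsetP => -[u v] uv.
    by rewrite rel_of_blocks_cat (@rel_of_blocks_cat [:: (B, true); (C, true)]) uv !orbT.
  (* Of the four products that make up the square of [B :|: C], only [setX C B] is new. *)
  rewrite rel_of_blocks1 rel_of_blocks2 !subUset => /and3P[/subsetP BC /subsetP BB /subsetP CC].
  move/subsetP: CBV => CB; apply/subsetP => -[u v].
  by rewrite !inE => /andP[/orP[] u_ /orP[] v_];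
     [apply: BB|apply: BC|apply: CB|apply: CC]; rewrite inE u_.
Qed.

(** * Covers and extreme elements of the poset *)

Lemma disjoint_obip (b : obip X) : disjoint_blocks b.
Proof. by have := valP b; rewrite ordered_partitionE => /andP[]. Qed.

Lemma move_rank (U V : Bip X) : move (obip_repr U) (obip_repr V) ->
  bip_rank V = (bip_rank U + 1)%R.
Proof. move/(move_weight (disjoint_obip _)) => w.
by rewrite [LHS]bip_rankE w [in RHS]bip_rankE; apply: addrAC. Qed.

Lemma move_lt (U V : Bip X) : move (obip_repr U) (obip_repr V) -> (U < V)%O.
Proof.
move=> UV; rewrite lt_neqAle; apply/andP; split.
  by apply/eqP => E; have := move_rank UV; rewrite E; lia.
by have := move_sub UV; rewrite -{2}[U]obip_reprK -{2}[V]obip_reprK.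
Qed.

(** By uniqueness, the list given by [exists_move] is the representation of its own relation. *)
Lemma lt_move (U V : Bip X) : (U < V)%O ->
  exists2 W, move (obip_repr U) (obip_repr W) & (W <= V)%O.
Proof.
rewrite lt_neqAle => /andP[UV leUV].
have rU : rel_of_blocks (obip_repr U) = rel_of U.
  by rewrite -[in RHS](obip_reprK U).
have prUV : rel_of_blocks (obip_repr U) \proper rel_of V.
  by rewrite rU properEneq; apply/andP.
have [c [pc Uc cV]] := exists_move (valP V) (valP (obip_repr U)) prUV.
by exists (bip_of_obip (MkObip pc)); rewrite ?bip_of_obipK.
Qed.

Lemma bip_rank_step (U V : Bip X) : (U < V)%O ->
  exists2 W, (U < W <= V)%O & bip_rank W = (bip_rank U + 1)%R.
Proof.
case/lt_move => W UW WV; exists W; last exact: move_rank.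
by rewrite WV andbT; apply: move_lt.
Qed.

(** The move found below a cover [V] must lead to [V] itself; conversely, a move raises the rank by
    only one. *)
Lemma coversP (U V : Bip X) : covers U V <-> move (obip_repr U) (obip_repr V).
Proof.
split=> [[/lt_move[W UW WV] /(_ W)]|UV].
  have [<- //|WneV] := eqVneq W V.
  by case/negP; apply/andP; split; [exact: move_lt|rewrite lt_neqAle WneV].
by apply: (covers_of_rank bip_rank_step); [apply: move_lt|apply: move_rank].
Qed.

(** The single block gives the least relation for [e = false] and the greatest for [e = true];
    blocks are nonempty, whence the condition on [X]. *)
Lemma ordered_partition_setT (e : bool) : 0 < #|X| ->
  ordered_partition (unzip1 [:: ([set: X], e)]).
Proof. by move=> X0; rewrite /ordered_partition /= big_seq1 eqxx -card_gt0 cardsT X0. Qed.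

End Moves.

Theorem theorem5p1 (X : finType) (X_nonempty : 0 < #|X|) :
  (forall U V : Bip X,
     covers U V <->
     [\/ join_underlined (obip_repr U) (obip_repr V),
         separate_nonunderlined (obip_repr U) (obip_repr V)
       | underline_singleton (obip_repr U) (obip_repr V)]) /\
  (graded (Bip X) /\ rank_function (@bip_rank X)).
Proof.
pose full e := bip_of_obip (MkObip (ordered_partition_setT e X_nonempty)).
have bot_le U : (full false <= U)%O.
  by rewrite /Order.le /= /Bip_le /= rel_of_blocks1 sub0set.
have le_top U : (U <= full true)%O.
  rewrite /Order.le /= /Bip_le /= rel_of_blocks1.
  by apply/subsetP => -[x y] _; rewrite !inE.
split; first exact: coversP.
split; first exact: stepwise_rank_graded (@bip_rank_step X) _ _ bot_le le_top.
split; last exact: stepwise_rank_covers (@bip_rank_step X).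
(* A minimal element is the empty relation, one nonunderlined block, of rank 1 - 1. *)
move=> U /(_ (full false)); rewrite lt_neqAle bot_le andbT negbK => /eqP<-.
by rewrite bip_rankE bip_of_obipK big_seq1 /block_weight.
Qed.
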